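(* Let $T\subset\mathbb{R}^3$ be the closed tetrahedron with vertices $(1,1,1)$, $(-1,-1,1)$, $(-1,1,-1)$, $(1,-1,-1)$, and let $$R_0=\begin{pmatrix}0&0&-1\\0&-1&0\\1&0&0\end{pmatrix}.$$ Let $\mathbf{x}$ be a random point uniformly distributed on $T$, and for $f:T\to\mathbb{R}$ define the four-point stochastic quadrature rule $$Q_M(f)=\frac23\left(f(\mathbf{x})+f(R_0\mathbf{x})+f(R_0^2\mathbf{x})+f(R_0^3\mathbf{x})\right).$$ Then $Q_M$ is of order $1$ and unbiased on $T$.
   Context: A stochastic quadrature rule on a bounded domain $\Omega_0\subset\mathbb{R}^d$ is a random functional $Q_M(f)=\sum_{j=1}^J f(\mathbf{x}_j)w_j$, where the points and weights $(\mathbf{x}_j,w_j)_{j=1}^J\in(\Omega_0\times\mathbb{R})^J$ are sampled from a probability measure. The rule is of order $p$ if, with probability $1$, $Q_M(f)=\int_{\Omega_0}f(\mathbf{x})\,d\mathbf{x}$ for every polynomial $f$ of degree at most $p$. The rule is unbiased if $\mathbb{E}(Q_M(f))=\int_{\Omega_0}f(\mathbf{x})\,d\mathbf{x}$ for all integrable $f:\Omega_0\to\mathbb{R}$. *)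

(* Defs.v *)
From HB Require Import structures.
From mathcomp Require Import all_boot all_order all_algebra.
From mathcomp Require Import all_classical all_reals all_analysis.
From mathcomp Require Import (coercions, canonicals) mpoly.

Set Implicit Arguments.
Unset Strict Implicit.
Unset Printing Implicit Defensive.

Import Order.TTheory GRing.Theory Num.Theory.
Import numFieldNormedType.Exports.

Local Open Scope classical_set_scope.
Local Open Scope ring_scope.

(* R^3 as an iterated product carries the library's product sigma-algebra
   (the Borel sets); col3 and pt3 are the mutually inverse identifications with
   column vectors, on which matrices act. *)
Notation R3 R :=
  (measurableTypeR R * measurableTypeR R * measurableTypeR R)%type.

Definition col3 (R : realType) (x : R3 R) : 'cV[R]_3 :=
  \col_(i < 3) [:: x.1.1; x.1.2; x.2]`_i.

Definition pt3 (R : realType) (v : 'cV[R]_3) : R3 R :=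
  (v 0 0, v 1 0, v 2%:R 0).

Definition mxact (R : realType) (A : 'M[R]_3) (x : R3 R) : R3 R :=
  pt3 (A *m col3 x).

(* Lebesgue measure on R^3, on the Borel sets. *)
Definition vol3 (R : realType) : {measure set (R3 R) -> \bar R} :=
  ((@lebesgue_measure R \x @lebesgue_measure R) \x @lebesgue_measure R)%E.
Arguments vol3 R : clear implicits.

(* Its completion, on the sigma-algebra of Lebesgue measurable sets: functions
   integrable for leb3 are the Lebesgue integrable functions, which need not be
   Borel measurable. *)
Definition leb3 (R : realType) :=
  @completed_measure_extension _ _ _ (vol3 R).
Arguments leb3 R : clear implicits.
HB.instance Definition _ (R : realType) := Measure.on (leb3 R).

Definition evalp (R : realType) (q : mpoly.mpoly 3 R) (x : R3 R) : R :=
  mpoly.meval (fun i => col3 x i 0) q.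

(* mpoly.msize is 1 + the total degree (0 for the zero polynomial). *)
Definition degree_le (R : realType) (p : nat) (q : mpoly.mpoly 3 R) : Prop :=
  (mpoly.msize q <= p.+1)%N.

(* A random functional Q maps f : R^3 -> R to the random variable Q f. A
   function on a domain D is represented by a function on R^3, of which only
   the values on D matter. *)
Section quadrature.
Context (R : realType) (d : measure_display) (Omega : measurableType d).
Variables (P : probability Omega R) (D : set (R3 R)).
Variable Q : (R3 R -> R) -> Omega -> R.

Definition stochastic_quadrature_rule : Prop :=
  exists (J : nat) (x : 'I_J -> {RV P >-> R3 R}) (w : 'I_J -> {RV P >-> R}),
    {ae P, forall omega, forall j, D (x j omega)} /\
    forall f omega, Q f omega = \sum_(j < J) f (x j omega) * w j omega.

Definition of_order (p : nat) : Prop :=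
  {ae P, forall omega, forall q : mpoly.mpoly 3 R, degree_le p q ->
     (Q (evalp q) omega)%:E = \int[leb3 R]_(x in D) (evalp q x)%:E}%E.

(* Z has expectation m. Since Z = Q f may be measurable only up to a P-null set
   (f is Lebesgue measurable, and the nodes lie in D almost surely), the
   expectation is that of an integrable random variable almost surely equal
   to Z. *)
Definition has_expectation (Z : Omega -> R) (m : \bar R) : Prop :=
  exists Y : {RV P >-> R},
    [/\ P.-integrable [set: Omega] (EFin \o Y),
        {ae P, forall omega, Z omega = Y omega} &
        'E_P[Y] = m]%E.

Definition unbiased : Prop :=
  forall f : R3 R -> R,
    (leb3 R).-integrable D (EFin \o f) ->
    has_expectation (Q f) (\int[leb3 R]_(x in D) (f x)%:E)%E.

End quadrature.

Definition uniform_on (R : realType) (d : measure_display)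
    (Omega : measurableType d) (P : probability Omega R) (D : set (R3 R))
    (X : {RV P >-> R3 R}) : Prop :=
  forall A : set (R3 R), measurable A ->
    distribution P X A = (vol3 R (A `&` D) / vol3 R D)%E.

Definition tetra_vertex (R : realType) (i : 'I_4) : R3 R :=
  nth (0, 0, 0)
    [:: (1, 1, 1); (-1, -1, 1); (-1, 1, -1); (1, -1, -1)] i.

Definition tetrahedron (R : realType) : set (R3 R) :=
  [set x | exists l : 'I_4 -> R,
     [/\ forall i, 0 <= l i, \sum_i l i = 1 &
         col3 x = \sum_i l i *: col3 (tetra_vertex R i)]].
Arguments tetrahedron R : clear implicits.

Definition R0 (R : realType) : 'M[R]_3 :=
  \matrix_(i, j) (nth [::] [:: [:: 0; 0; -1];
                               [:: 0; -1; 0];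
                               [:: 1; 0; 0]] i)`_j.

Definition QM (R : realType) (Omega : Type) (X : Omega -> R3 R)
    (f : R3 R -> R) (omega : Omega) : R :=
  let x := X omega in
  2 / 3 * (f x + f (mxact (R0 R) x) + f (mxact (R0 R ^+ 2) x)
               + f (mxact (R0 R ^+ 3) x)).

(* Main.v *)
(* The rotation R0 is a signed permutation matrix, so it preserves Lebesgue
   measure; it permutes the vertices of T, so it preserves the uniform
   distribution on T.  Each of the four nodes is thus uniform on T, and as
   |T| = 8/3 it contributes (2/3) / |T| = 1/4 of the integral to the expectation.
   For an affine f the rule is constant, because the four rotates of a point sum
   to 0; being unbiased, the rule then equals the integral, hence order 1. *)

Require Import Defs.
From HB Require Import structures.
From mathcomp Require Import all_boot all_order all_algebra.
From mathcomp Require Import all_classical all_reals all_analysis.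
From mathcomp Require Import measurable_realfun ring lra.
From mathcomp Require Import (coercions, canonicals) mpoly.

Set Implicit Arguments.
Unset Strict Implicit.
Unset Printing Implicit Defensive.

Import Order.TTheory GRing.Theory Num.Theory.
Import numFieldNormedType.Exports.

Local Open Scope classical_set_scope.
Local Open Scope ring_scope.

(** * Lebesgue measure on boxes, uniqueness, reflection of the line *)

Section vol3.
Local Open Scope ereal_scope.
Context {R : realType}.
Local Notation leb := (@lebesgue_measure R).
Local Notation T := (measurableTypeR R).

Lemma vol3_box (A B C : set T) : measurable A -> measurable B -> measurable C ->
  vol3 R (A `*` B `*` C) = leb A * leb B * leb C.
Proof.
move=> mA mB mC; rewrite /vol3 /= product_measure1E//; last exact: measurableX.
by rewrite /= product_measure1E.
Qed.

Definition box3 : set (set (R3 R)) := [set E | exists A B C : set T,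
  [/\ measurable A, measurable B, measurable C & E = A `*` B `*` C]].

(** The coordinate maps are measurable for the sigma-algebra generated by boxes, hence so is the
    identity, which is their pairing. *)
Lemma measurable_box3 : @measurable _ (R3 R) = <<s box3 >>.
Proof.
apply/seteqP; split; last first.
  apply: smallest_sub; first exact: sigma_algebra_measurable.
  by move=> _ [A [B [C [mA mB mC ->]]]]; do 2 apply: measurableX => //.
pose B3 := g_sigma_algebraType box3.
have mB3 (A B C : set T) : measurable A -> measurable B -> measurable C ->
    @measurable _ B3 (A `*` B `*` C).
  by move=> mA mB mC; apply: sub_sigma_algebra; exists A, B, C.
have m1 : measurable_fun [set: B3] ((fun x => x.1.1) : B3 -> T).
  move=> _ A mA; rewrite setTI.
  rewrite (_ : _ @^-1` A = A `*` setT `*` setT); first exact: mB3.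
  by apply/seteqP; split => [x|x [[]]].
have m2 : measurable_fun [set: B3] ((fun x => x.1.2) : B3 -> T).
  move=> _ A mA; rewrite setTI.
  rewrite (_ : _ @^-1` A = setT `*` A `*` setT); first exact: mB3.
  by apply/seteqP; split => [x|x [[]]].
have m3 : measurable_fun [set: B3] ((fun x => x.2) : B3 -> T).
  move=> _ A mA; rewrite setTI.
  rewrite (_ : _ @^-1` A = setT `*` setT `*` A); first exact: mB3.
  by apply/seteqP; split => [x|x [[]]].
have := measurable_fun_pair (measurable_fun_pair m1 m2) m3.
rewrite [X in measurable_fun _ X](_ : _ = id :> (B3 -> R3 R)); last first.
  by apply/funext => -[[]].
by move=> mid E mE; have := mid measurableT E mE; rewrite setTI preimage_id.
Qed.

(** Boxes form a generating family stable under intersection, and the cubes [I n] of finite volume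
    exhaust the space, so a measure is determined by its values on boxes. *)
Lemma vol3_unique (m : {measure set (R3 R) -> \bar R}) :
  (forall A B C, measurable A -> measurable B -> measurable C ->
    m (A `*` B `*` C) = leb A * leb B * leb C) ->
  forall E, measurable E -> vol3 R E = m E.
Proof.
move=> mbox E mE.
pose I n : set T := `[(- n%:R)%R, n%:R%R]%classic.
have mI n : measurable (I n) by exact: measurable_itv.
apply: (measure_unique box3 (fun n => I n `*` I n `*` I n)) => //.
- exact: measurable_box3.
- move=> _ _ [A [B [C [mA mB mC ->]]]] [A' [B' [C' [mA' mB' mC' ->]]]].
  exists (A `&` A'), (B `&` B'), (C `&` C'); split; try exact: measurableI.
  by rewrite -!setXI.
- by move=> n; exists (I n), (I n), (I n).
- apply/seteqP; split => // -[[x y] z] _.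
  (* One integer above the sum of the absolute values bounds all three coordinates at once. *)
  pose n := Num.bound (`|x| + `|y| + `|z|)%R.
  have := archi_boundP (addr_ge0 (addr_ge0 (normr_ge0 x) (normr_ge0 y))
    (normr_ge0 z)).
  rewrite -/n => xyz; exists n => //.
  have [? ? ?] : [/\ `|x| <= n%:R, `|y| <= n%:R & `|z| <= n%:R]%R.
    by have := (normr_ge0 x, normr_ge0 y, normr_ge0 z); case=> -[]; split; lra.
  by split; [split|]; rewrite /I/= in_itv/= -ler_norml.
- by move=> _ [A [B [C [mA mB mC ->]]]]; rewrite mbox// vol3_box.
- move=> n; rewrite vol3_box//.
  have Ifin : leb (I n) \is a fin_num.
    by rewrite /I lebesgue_measure_itv/= lte_fin; case: ifPn.
  by rewrite ltey_eq !fin_numM.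
Qed.

Lemma lebesgue_measure_opp (A : set T) : measurable A ->
  leb (-%R @^-1` A) = leb A.
Proof.
move=> mA; have mopp : measurable_fun [set: T] (-%R : T -> T).
  exact: oppr_measurable.
pose opp : {mfun T >-> T} :=
  HB.pack (-%R : T -> T) (isMeasurableFun.Build _ _ _ _ _ mopp).
rewrite [RHS](@lebesgue_measure_unique _ (pushforward leb opp))//.
move=> _ [[a b] _ <-] /=; rewrite /pushforward/=.
(* Negation moves the closed end of the half-open interval to the other side; the length is
   unchanged. *)
rewrite (_ : _ @^-1` _ = `[(- b)%R, (- a)%R[%classic); last first.
  by apply/seteqP; split => x /=; rewrite !in_itv/=; lra.
rewrite !lebesgue_measure_itv/= !lte_fin ltrN2; case: ifPn => // _.
by rewrite -!EFinB opprK addrC.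
Qed.

End vol3.

(** * Measurability of closed half-spaces and affine functions *)

Lemma measurable_set_ge0 d (T : measurableType d) (R : realType) (f : T -> R) :
  measurable_fun setT f -> measurable [set x | 0 <= f x].
Proof.
move=> mf; rewrite (_ : mkset _ = f @^-1` `[0, +oo[%classic).
  by rewrite -[X in measurable X]setTI; apply: mf.
by apply/seteqP; split => x; rewrite /= in_itv/= andbT.
Qed.

Lemma measurable_affine (R : realType) (c a1 a2 a3 : R) :
  measurable_fun [set: R3 R] (fun x => c + a1 * x.1.1 + a2 * x.1.2 + a3 * x.2).
Proof.
have mD (f g : R3 R -> R) : measurable_fun setT f -> measurable_fun setT g ->
    measurable_fun setT (fun x => f x + g x) by exact: measurable_funD.
have mZ (a : R) (f : R3 R -> R) : measurable_fun setT f ->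
    measurable_fun setT (fun x => a * f x).
  by move=> mf; apply: measurable_funM => //; exact: measurable_cst.
have m11 : measurable_fun [set: R3 R] (fun x => x.1.1 : R).
  exact: measurableT_comp.
have m12 : measurable_fun [set: R3 R] (fun x => x.1.2 : R).
  exact: measurableT_comp.
have m2 : measurable_fun [set: R3 R] (fun x => x.2 : R).
  exact: measurable_snd.
apply: (mD _ _ _ (mZ _ _ m2)); apply: (mD _ _ _ (mZ _ _ m12)).
by apply: (mD _ _ _ (mZ _ _ m11)); exact: measurable_cst.
Qed.

(** * The action of [R0] on space and on the tetrahedron *)

Section rotation.
Context {R : realType}.
Local Notation T := (measurableTypeR R).

Lemma mxact1 (x : R3 R) : mxact 1 x = x.
Proof. by rewrite /mxact mul1mx /pt3 !mxE; case: x => -[]. Qed.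

Lemma mxactM (A B : 'M[R]_3) (x : R3 R) :
  mxact (A *m B) x = mxact A (mxact B x).
Proof.
rewrite /mxact; congr (pt3 _); rewrite -mulmxA; congr (_ *m _).
by apply/matrixP => -[[|[|[|//]]] ?] j; rewrite ord1 [RHS]mxE /=;
  congr (_ _ _); apply/val_inj.
Qed.

Lemma mxactR0 (x : R3 R) : mxact (R0 R) x = (- x.2, - x.1.2, x.1.1).
Proof.
rewrite /mxact /pt3; congr (_, _, _);
  by rewrite mxE !big_ord_recl big_ord0 !mxE /=; ring.
Qed.

Lemma mxactR0E : mxact (R0 R) = fun x : R3 R => (- x.2, - x.1.2, x.1.1).
Proof. by apply/funext => x; exact: mxactR0. Qed.

Lemma mxactR0X2 (x : R3 R) : mxact (R0 R ^+ 2) x = (- x.1.1, x.1.2, - x.2).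
Proof. by rewrite expr2 mxactM !mxactR0/= opprK. Qed.

Lemma mxactR0X3 (x : R3 R) : mxact (R0 R ^+ 3) x = (x.2, - x.1.2, - x.1.1).
Proof. by rewrite exprS mxactM mxactR0X2 mxactR0/= opprK. Qed.

Lemma measurable_mxactR0 : measurable_fun [set: R3 R] (mxact (R0 R)).
Proof.
rewrite mxactR0E.
apply: measurable_fun_pair; last exact: measurableT_comp.
apply: measurable_fun_pair; first exact: measurable_funN.
by apply: measurable_funN; exact: measurableT_comp.
Qed.

(** By uniqueness it suffices to look at boxes, and the preimage of A x B x C is C x (-B) x (-A). *)
Lemma vol3_mxactR0 (E : set (R3 R)) : measurable E ->
  vol3 R (mxact (R0 R) @^-1` E) = vol3 R E.
Proof.
move=> mE.
have mopp : measurable_fun [set: T] (-%R : T -> T) by exact: oppr_measurable.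
pose rot : {mfun R3 R >-> R3 R} :=
  HB.pack (mxact (R0 R)) (isMeasurableFun.Build _ _ _ _ _ measurable_mxactR0).
rewrite [RHS](@vol3_unique _ (pushforward (vol3 R) rot))// => A B C mA mB mC.
have mN (D : set T) : measurable D -> measurable (-%R @^-1` D : set T).
  by move=> mD; rewrite -[X in measurable X]setTI; exact: mopp.
transitivity (vol3 R (C `*` (-%R @^-1` B) `*` (-%R @^-1` A))).
  rewrite /pushforward/=; congr (vol3 R _).
  rewrite mxactR0E; apply/seteqP; split => x /=; tauto.
rewrite vol3_box//; try exact: mN.
by rewrite !lebesgue_measure_opp// muleC muleA muleAC.
Qed.

(** Each of the four affine forms is 4 times a barycentric coordinate: it takes the value 4 at one
    vertex and 0 at the other three. Dividing by 4 therefore recovers the weights. *)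
Lemma tetrahedronE (x : R3 R) : tetrahedron R x <->
  [/\ 0 <= 1 + x.1.1 + x.1.2 + x.2, 0 <= 1 - x.1.1 - x.1.2 + x.2,
      0 <= 1 - x.1.1 + x.1.2 - x.2 & 0 <= 1 + x.1.1 - x.1.2 - x.2].
Proof.
case: x => -[x y] z /=; split.
  move=> [l [l0 l1 /matrixP xE]].
  have := (xE 0 0, xE 1 0, xE 2%:R 0).
  move: l1; rewrite !big_ord_recl !big_ord0 !mxE/=.
  move: (l0 ord0) (l0 (lift ord0 ord0)) (l0 (lift ord0 (lift ord0 ord0)))
    (l0 (lift ord0 (lift ord0 (lift ord0 ord0)))) => ? ? ? ? ? [[? ?] ?].
  by split; lra.
move=> [h1 h2 h3 h4].
exists (fun i => [:: (1 + x + y + z) / 4; (1 - x - y + z) / 4;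
                     (1 - x + y - z) / 4; (1 + x - y - z) / 4]`_i).
split.
- by move=> [[|[|[|[|//]]]] ?] /=; lra.
- by rewrite !big_ord_recl big_ord0/=; lra.
- apply/matrixP => -[[|[|[|//]]] ?] j; rewrite !big_ord_recl big_ord0 !mxE/=; lra.
Qed.

(** Composition with [R0] permutes the four face inequalities cyclically. *)
Lemma tetrahedron_mxactR0 (x : R3 R) :
  tetrahedron R (mxact (R0 R) x) <-> tetrahedron R x.
Proof. by rewrite !tetrahedronE mxactR0E/=; split=> -[]; split; lra. Qed.

Lemma measurable_tetrahedron : measurable (tetrahedron R).
Proof.
have mplane (a1 a2 a3 : R) :
    measurable [set x : R3 R | 0 <= 1 + a1 * x.1.1 + a2 * x.1.2 + a3 * x.2].
  by apply: measurable_set_ge0; exact: measurable_affine.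
have := measurableI _ _ (measurableI _ _ (mplane 1 1 1) (mplane (-1) (-1) 1))
  (measurableI _ _ (mplane (-1) 1 (-1)) (mplane 1 (-1) (-1))).
congr measurable; apply/seteqP; split => x /=; rewrite tetrahedronE.
  by case=> -[? ?] [? ?]; split; lra.
by case=> ? ? ? ?; split; split; lra.
Qed.

End rotation.

(** * The volume of the tetrahedron *)

Lemma product_measure12 d1 d2 (T1 : measurableType d1) (T2 : measurableType d2)
    (R : realType) (m1 : {sigma_finite_measure set T1 -> \bar R})
    (m2 : {sigma_finite_measure set T2 -> \bar R}) (A : set (T1 * T2)) :
  measurable A -> (m1 \x m2)%E A = (m1 \x^ m2)%E A.
Proof.
move=> mA.
by apply: product_measure_unique => // B C mB mC; rewrite /= product_measure2E.
Qed.

Section volume.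
Context {R : realType}.
Local Notation T := (measurableTypeR R).
Local Notation leb := (@lebesgue_measure R).

(* Its vertical sections are half as long as those of the tetrahedron, and its
   horizontal sections are squares. *)
Definition pyramid : set (R3 R) :=
  [set x | [/\ 0 <= x.2, `|x.1.1| + x.2 <= 1 & `|x.1.2| + x.2 <= 1]].

(** The integrand is the area of the horizontal section of the pyramid at height t, a square of side
    2(1 - t). *)
Lemma integral_square :
  (\int[leb]_(t in `[0%R, 1%R]) (4 * (1 - t) ^+ 2)%:E = (4 / 3)%:E)%E.
Proof.
pose F (t : R) : R := - (4 / 3) * (1 - t) ^+ 3.
have dF (t : R) : is_derive t 1 F (4 * (1 - t) ^+ 2).
  by rewrite /F; apply: is_derive_eq; rewrite /GRing.scale/=; field.
have cF (x : R) : {for x, continuous F}.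
  by apply: differentiable_continuous; apply/derivable1_diffP; case: (dF x).
rewrite (@continuous_FTC2 _ (fun t => 4 * (1 - t) ^+ 2) F).
- by rewrite /F -EFinB; congr (_%:E); field.
- by [].
- apply: continuous_subspaceT => x.
  have df : is_derive x 1 (fun t : R => 4 * (1 - t) ^+ 2) (- 8 * (1 - x)).
    by apply: is_derive_eq; rewrite /GRing.scale/=; ring.
  by apply: differentiable_continuous; apply/derivable1_diffP; case: df.
- split.
  + by move=> x _; case: (dF x).
  + by apply: cvg_at_right_filter; exact: cF.
  + by apply: cvg_at_left_filter; exact: cF.
- by move=> x _; rewrite derive1E; case: (dF x).
Qed.

Lemma measurable_pyramid : measurable pyramid.
Proof.
have -> : pyramid = [set x : R3 R | 0 <= x.2] `&`
    [set x : R3 R | 0 <= 1 - `|x.1.1| - x.2] `&`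
    [set x : R3 R | 0 <= 1 - `|x.1.2| - x.2].
  apply/seteqP; split => x; rewrite /pyramid/=.
    by case=> ? ? ?; split; [split|]; lra.
  by case=> -[? ?] ?; split; lra.
have mz : measurable_fun [set: R3 R] (fun x => x.2 : R).
  exact: measurable_snd.
have mB (f : R3 R -> R) : measurable_fun [set: R3 R] f ->
    measurable_fun [set: R3 R] (fun x => 1 - `|f x| - x.2).
  move=> mf; apply: measurable_funB => //; apply: measurable_funB => //.
  exact: measurableT_comp.
do 2?apply: measurableI; apply: measurable_set_ge0 => //; apply: mB;
  exact: measurableT_comp.
Qed.

Lemma sigma_finite_leb2 : sigma_finite setT (leb \x leb)%E.
Proof.
pose I n : set T := `[- n%:R, n%:R]%classic.
have mI n : measurable (I n) by exact: measurable_itv.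
exists (fun n => I n `*` I n).
  apply/esym/seteqP; split => // -[x y] _.
  have := archi_boundP (addr_ge0 (normr_ge0 x) (normr_ge0 y)).
  set n := Num.bound _ => xy; exists n => //.
  have [? ?] : `|x| <= n%:R /\ `|y| <= n%:R.
    by have := (normr_ge0 x, normr_ge0 y); case; split; lra.
  by split; rewrite /I/= in_itv/= -ler_norml.
move=> n; split; first exact: measurableX.
have Ifin : leb (I n) \is a fin_num.
  by rewrite /I lebesgue_measure_itv/= lte_fin; case: ifPn.
by rewrite product_measure1E// ltey_eq fin_numM.
Qed.

Lemma vol3_pyramid : vol3 R pyramid = (4 / 3)%:E.
Proof.
rewrite -integral_square integral_mkcond /vol3 /=.
(* The library's canonical sigma-finite structure on products only covers
   subprobabilities. *)
pose leb2 : {sigma_finite_measure set (T * T)%type -> \bar R} :=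
  HB.pack (leb \x leb)%E
    (Measure_isSigmaFinite.Build _ _ _ (leb \x leb)%E sigma_finite_leb2).
(* Slicing horizontally needs the other order of integration: [product_measure2] integrates the
   areas of the sections over the last coordinate. *)
rewrite [LHS](product_measure12 leb2 leb measurable_pyramid).
rewrite /product_measure2; apply: eq_integral => t _; rewrite patchE /=.
case: ifPn => [|/negP]; rewrite inE/= in_itv/= => t01.
  have -> : ysection pyramid t = `[t - 1, 1 - t] `*` `[t - 1, 1 - t].
    apply/seteqP; split => -[x y];
      rewrite /ysection/= inE/= !in_itv/= /pyramid/=.
      case=> ? ? ?; have [] : `|x| <= 1 - t /\ `|y| <= 1 - t by lra.
      by rewrite !ler_norml opprB.
    case=> xt yt; have [] : `|x| <= 1 - t /\ `|y| <= 1 - t.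
      by rewrite !ler_norml opprB.
    by split; lra.
  rewrite product_measure1E//= lebesgue_measure_itv/= lte_fin.
  case: ifPn => t1; first by rewrite -EFinD -EFinM; congr (_%:E); ring.
  (* At the apex the square degenerates to a point. *)
  have -> : t = 1 by lra.
  by rewrite subrr expr0n/= mulr0 mule0.
rewrite (_ : ysection _ _ = set0) ?measure0//.
apply/seteqP; split => // -[x y].
rewrite /ysection/= inE/= /pyramid/= => -[t0 xt _].
by apply: t01; have := normr_ge0 x; lra.
Qed.

Lemma vol3_tetrahedron : vol3 R (tetrahedron R) = (8 / 3)%:E.
Proof.
have -> : (8 / 3)%:E = (2%:E * vol3 R pyramid)%E.
  by rewrite vol3_pyramid -EFinM; congr (_%:E); field.
rewrite /vol3 /=.
transitivity (\int[(leb \x leb)%E]_p (2%:E * leb (xsection pyramid p)))%E;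
  last first.
  rewrite ge0_integralZl//.
  by apply: measurable_fun_xsection; exact: measurable_pyramid.
apply: eq_integral => -[x y] _ /=.
(* The face inequalities pair up into |x + y| <= 1 + z and |x - y| <= 1 - z. *)
have -> : xsection (tetrahedron R) (x, y) =
    `[`|x + y| - 1, 1 - `|x - y|]%classic.
  apply/seteqP; split => z; rewrite /xsection/= inE tetrahedronE/= in_itv/=.
    move=> [? ? ? ?]; have [? ?] : `|x + y| <= 1 + z /\ `|x - y| <= 1 - z.
      by rewrite !ler_norml; split; lra.
    by lra.
  move=> zxy; have [] : `|x + y| <= 1 + z /\ `|x - y| <= 1 - z by lra.
  by rewrite !ler_norml => ? ?; split; lra.
have -> : xsection pyramid (x, y) =
    `[0, Num.min (1 - `|x|) (1 - `|y|)]%classic.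
  apply/seteqP; split => z; rewrite /xsection/= inE /pyramid/= in_itv/= le_min.
    by move=> [? ? ?]; lra.
  by move=> ?; split; lra.
(* This is |x + y| + |x - y| = 2 max(|x|, |y|) in disguise. *)
have len : 1 - `|x - y| - (`|x + y| - 1) = 2 * Num.min (1 - `|x|) (1 - `|y|).
  by case: (ger0P x) => ?; case: (ger0P y) => ?; case: (ger0P (x + y)) => ?;
    case: (ger0P (x - y)) => ?; case: leP => ?; lra.
(* By [len] both intervals have positive length for the same (x, y), so one case split settles
   both. *)
rewrite !lebesgue_measure_itv/= !lte_fin -subr_gt0 len pmulr_rgt0//.
by case: ifPn => _; rewrite ?mule0// oppr0 adde0 -EFinD len EFinM.
Qed.

End volume.

(** * Comparing a measure with its completion *)

Section completion.
Local Open Scope ereal_scope.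
Context d (T : measurableType d) (R : realType).
Variable mu : {measure set T -> \bar R}.
Local Notation cmu := (@completed_measure_extension _ _ _ mu).
Local Notation ct := (caratheodory_type (mu^*)%mu).

Lemma completed_measureE (A : set T) : measurable A -> cmu A = mu A.
Proof. exact: measurable_mu_extE. Qed.

Lemma measurable_completed (A : set T) : measurable A -> measurable (A : set ct).
Proof. by move=> mA; exact: caratheodory_measurable_mu_ext. Qed.

Lemma measurable_fun_completed d' (T' : measurableType d') (D : set T)
    (f : T -> T') : measurable D ->
  measurable_fun setT f -> measurable_fun (D : set ct) (f : ct -> T').
Proof.
move=> mD mf _ B mB; apply: measurable_completed.
by apply: measurableI => //; rewrite -[X in measurable X]setTI; exact: mf.
Qed.

(** On an arbitrary set [cmu] is the outer measure, an infimum over countable measurable covers;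
    intersecting covers within 1/(n+1) of it attains the infimum. *)
Lemma measurable_hull (X : set T) : cmu X < +oo ->
  exists F, [/\ measurable F, X `<=` F & mu F = cmu X].
Proof.
move=> Xoo.
have Xfin : cmu X \is a fin_num by rewrite ge0_fin_numE.
have cover n : exists A : (set T)^nat, measurable_cover X A /\
    \sum_(k <oo) mu (A k) < cmu X + n.+1%:R^-1%:E.
  have n0 : (0 < n.+1%:R^-1 :> R)%R by rewrite invr_gt0.
  by have [_ [A XA <-] ?] := lb_ereal_inf_adherent n0 Xfin; exists A.
have [A AP] := choice cover.
have mF : measurable (\bigcap_n \bigcup_k A n k).
  apply: bigcapT_measurable => n; apply: bigcupT_measurable => k.
  exact: (AP n).1.1.
have XF : X `<=` \bigcap_n \bigcup_k A n k.
  by move=> x Xx n _; exact: (AP n).1.2.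
exists (\bigcap_n \bigcup_k A n k); split => //.
apply/eqP; rewrite eq_le; apply/andP; split; last first.
  by rewrite -completed_measureE//; exact: le_mu_ext.
apply/lee_addgt0Pr => _/posnumP[e]; near \oo => n.
have Fn : mu (\bigcap_n \bigcup_k A n k) <= \sum_(k <oo) mu (A n k).
  rewrite -completed_measureE//; apply: ereal_inf_lbound.
  by exists (A n) => //; split; [exact: (AP n).1.1|exact: bigcap_inf].
rewrite (le_trans Fn)// (le_trans (ltW (AP n).2))// leeD2l// lee_fin ltW//.
by near: n; apply: near_infty_natSinv_lt.
Unshelve. all: by end_near. Qed.

Lemma completed_measurable_ae_eq (D E : set T) : measurable D -> mu D < +oo ->
  measurable (E : set ct) -> exists F N : set T,
    [/\ measurable F, measurable N, mu N = 0 &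
        forall x, D x -> ~ N x -> E x <-> F x].
Proof.
(* Hulls F of D `&` E and G of D `\` E have measures adding up to that of D, so
   they overlap in a null subset of D. *)
move=> mD Doo mE.
have mcD := measurable_completed mD.
have mcDE : measurable (D `&` E : set ct) by exact: measurableI.
have mcDNE : measurable (D `\` E : set ct) by exact: measurableD.
have DEoo : cmu (D `&` E) < +oo.
  by apply: le_lt_trans Doo; rewrite -completed_measureE//; exact: le_mu_ext.
have DNEoo : cmu (D `\` E) < +oo.
  by apply: le_lt_trans Doo; rewrite -completed_measureE//; exact: le_mu_ext.
have [F [mF DEF muF]] := measurable_hull DEoo.
have [G [mG DEG muG]] := measurable_hull DNEoo.
exists F, (F `&` G `&` D); split => //.
- by apply: measurableI => //; exact: measurableI.
(* [D] splits into two pieces measurable for the completion, on which [cmu] is additive. *)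
- have muD : mu D = mu F + mu G.
    rewrite muF muG -completed_measureE// -measureU//.
      by rewrite setUIDK.
    by apply/seteqP; split => // x [[_ ?] []].
  have DFG : D `\` F `<=` D `&` G `\` F.
    move=> x [Dx Fx]; split => //; split => //; apply: DEG; split => // Ex.
    by apply: Fx; exact: DEF.
  have mDF : measurable (D `&` F) by exact: measurableI.
  have mDG : measurable (D `&` G) by exact: measurableI.
  have le1 : mu (D `&` F) <= mu F by rewrite le_measure// inE.
  have le2 : mu (D `&` G) <= mu G by rewrite le_measure// inE.
  have le3 : mu (D `\` F) <= mu (D `&` G `\` F).
    by rewrite le_measure// inE; exact: measurableD.
  (* Split [D] along [F] and bound [D] minus [F] by the part of [G] outside [F]. Adding the overlap
     completes that part to [D] and [G], and the total is at most mu F + mu G = mu D. As mu D is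
     finite, it cancels. *)
  have : mu D + mu (F `&` G `&` D) <= mu D.
    rewrite [in leLHS](measureDI mu mD mF) [in leRHS]muD.
    rewrite (le_trans _ (leeD le1 le2))//.
    rewrite [in leRHS](measureDI mu mDG mF) addeAC addeC leeD2l//.
    have -> : F `&` G `&` D = D `&` G `&` F by rewrite setIC (setIC F) setIA.
    by rewrite leeD2r.
  have Dfin : mu D \is a fin_num by rewrite ge0_fin_numE.
  by rewrite -[leRHS]adde0 leeD2lE// measure_le0 => /eqP.
- move=> x Dx Nx; split=> [Ex|Fx]; first exact: DEF.
  by apply: contrapT => Ex; apply: Nx; split => //; split => //; exact: DEG.
Qed.

(** Replace each set f > q, for q rational, by a measurable one off a null set; the countable union
    of these null sets is the exceptional set. *)
Lemma completed_measurable_fun_ae (D : set T) (f : T -> R) :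
  measurable D -> mu D < +oo -> measurable_fun (D : set ct) (f : ct -> R) ->
  exists N : set T,
    [/\ measurable N, mu N = 0 & measurable_fun (D `\` N) f].
Proof.
move=> mD Doo mf.
have mcD := measurable_completed mD.
have level (q : rat) : exists FN : set T * set T,
    [/\ measurable FN.1, measurable FN.2, mu FN.2 = 0 &
        forall x, D x -> ~ FN.2 x -> (ratr q < f x)%R <-> FN.1 x].
  have mE : measurable (D `&` f @^-1` `]ratr q, +oo[%classic : set ct).
    exact: mf.
  have [F [N [mF mN N0 EF]]] := completed_measurable_ae_eq mD Doo mE.
  exists (F, N); split => //= x Dx Nx; rewrite -EF//=.
  by split=> [qf|[_]]; rewrite in_itv/= andbT.
have [FN FNP] := choice level.
pose N := \bigcup_q (FN q).2.
have mN : measurable N by apply: bigcupT_measurable_rat => q; have [] := FNP q.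
exists N; split => //.
- apply: measure_negligible => //.
  (* An enumeration of the rationals by naturals. Codes of no rational go to 0, which only repeats a
     set of the union. *)
  pose q n : rat := odflt 0%R (unpickle n).
  have -> : N = \bigcup_n (FN (q n)).2.
    apply/seteqP; split => x [i _ xi]; last by exists (q i).
    by exists (pickle i) => //; rewrite /q pickleK.
  apply: negligible_bigcup => n; have [_ mNn N0 _] := FNP (q n).
  exact/negligibleP.
- move=> mDN; apply: (measurability _ (RGenOInfty.measurableE R)) => //.
  move=> _ [_ [r ->] <-].
  (* By density, f > r holds iff f > q for some rational q >= r. *)
  rewrite [X in measurable X](_ : _ =
      \bigcup_(q in [set q : rat | r <= ratr q]%R) ((D `\` N) `&` (FN q).1)).
    rewrite bigcup_mkcond; apply: bigcupT_measurable_rat => q.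
    by case: ifPn => // _; apply: measurableI => //; have [] := FNP q.
  apply/seteqP; split => [x [[Dx Nx]]|x [q /= rq [[Dx Nx] Fx]]].
    rewrite /= in_itv/= andbT => rf.
    have [q] := rat_in_itvoo rf; rewrite in_itv/= => /andP[rq qf].
    exists q; first exact: ltW.
    split => //; have [_ _ _ /(_ x Dx) <-//] := FNP q.
    by move=> Nqx; apply: Nx; exists q.
  split => //=; rewrite in_itv/= andbT (le_lt_trans rq)//.
  have [_ _ _ /(_ x Dx) ->//] := FNP q.
  by move=> Nqx; apply: Nx; exists q.
Qed.

(** [mu] is the pushforward of [cmu] along the identity, which is measurable from the larger
    sigma-algebra to the smaller. *)
Lemma ge0_integral_completed (h : T -> \bar R) :
  measurable_fun setT h -> (forall x, 0 <= h x) ->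
  \int[cmu]_x h x = \int[mu]_x h x.
Proof.
move=> mh h0.
have mid : measurable_fun setT (id : ct -> T).
  by move=> _ A mA; rewrite setTI; exact: measurable_completed.
rewrite [RHS](eq_measure_integral (pushforward cmu (id : _ -> T))).
  by rewrite ge0_integral_pushforward.
by move=> A mA _; exact/esym/completed_measureE.
Qed.

(** Quantifying over [phi] transfers the integrals of the absolute value and of the positive and
    negative parts in one statement. *)
Lemma completed_measurable_modification (D : set T) (f : T -> R) :
  measurable D -> mu D < +oo -> measurable_fun (D : set ct) (f : ct -> R) ->
  exists (g : T -> R) (N : set T),
    [/\ measurable_fun setT g, measurable N, mu N = 0,
        forall x, D x -> ~ N x -> f x = g x &
        forall phi : \bar R -> \bar R,
          measurable_fun setT phi -> (forall y, 0 <= phi y) ->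
          \int[cmu]_(x in D) phi (f x)%:E = \int[mu]_(x in D) phi (g x)%:E].
Proof.
move=> mD Doo mf.
have mcD := measurable_completed mD.
have [N [mN N0 mDN]] := completed_measurable_fun_ae mD Doo mf.
pose g := f \_ (D `\` N).
have mg : measurable_fun setT g.
  by apply/(measurable_restrictT _ (measurableD mD mN)).
have fg x : D x -> ~ N x -> f x = g x.
  by move=> Dx Nx; rewrite /g patchE mem_set.
exists g, N; split => // phi mphi phi0.
have mphig : measurable_fun setT (fun x => phi (g x)%:E).
  by apply: measurableT_comp => //; exact/measurable_EFinP.
have mcf : measurable_fun (D : set ct) (fun x : ct => phi (f x)%:E).
  by apply: (measurableT_comp mphi); apply/measurable_EFinP; exact: mf.
have mcg : measurable_fun (D : set ct) (fun x : ct => phi (g x)%:E).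
  exact: measurable_fun_completed.
transitivity (\int[cmu]_(x in D) phi (g x)%:E).
  apply: ge0_ae_eq_integral; [exact: mcD|exact: mcf|exact: mcg| | |].
  - by move=> x _; exact: phi0.
  - by move=> x _; exact: phi0.
  - exists N; split.
    + exact: measurable_completed.
    + exact: etrans (completed_measureE mN) N0.
    + by move=> x /= /not_implyP[Dx]; apply: contra_notP => Nx; rewrite fg.
rewrite [LHS]integral_mkcond [RHS]integral_mkcond; apply: ge0_integral_completed.
- by apply/(measurable_restrictT _ mD); exact: measurable_funTS.
- by move=> x; rewrite patchE; case: ifPn.
Qed.

End completion.

(** * Expectations at a uniformly distributed point *)

Section uniform.
Local Open Scope ereal_scope.
Context (R : realType) (d : measure_display) (Omega : measurableType d).
Variables (P : probability Omega R) (D : set (R3 R)) (X : {RV P >-> R3 R}).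
Hypotheses (mD : measurable D) (XD : uniform_on D X).
Variable v : R.
Hypotheses (v0 : (0 < v)%R) (vD : vol3 R D = v%:E).

Lemma uniform_null (N : set (R3 R)) : measurable N ->
  vol3 R (N `&` D) = 0 -> {ae P, forall w, ~ N (X w)}.
Proof.
move=> mN ND0; exists (X @^-1` N); split.
- by rewrite -[X in measurable X]setTI; exact: measurable_funPT.
- by have := XD mN; rewrite ND0 mul0e.
- by move=> w /=; rewrite notK.
Qed.

Lemma uniform_in : {ae P, forall w, D (X w)}.
Proof.
have := @uniform_null (~` D) (measurableC mD).
rewrite setICl measure0 => /(_ erefl).
by apply: filterS => w; rewrite /= notK.
Qed.

(** The law of [X] gives no mass to the complement of [D], and on subsets of [D] it is the volume
    scaled by 1/v. *)
Lemma ge0_integral_uniform (h : R3 R -> \bar R) :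
  measurable_fun setT h -> (forall x, 0 <= h x) ->
  \int[P]_w h (X w) = (v^-1)%:E * \int[vol3 R]_(x in D) h x.
Proof.
move=> mh h0; rewrite -[LHS]/(\int[P]_w (h \o X) w) -ge0_integral_distribution//.
have D0 : distribution P X (~` D) = 0.
  by rewrite XD ?setICl ?measure0 ?mul0e//; exact: measurableC.
rewrite (ge0_negligible_integral _ _ _ _ D0)//; last exact: measurableC.
rewrite setDE setCK setTI.
have vV0 : (0 <= v^-1)%R by rewrite invr_ge0 ltW.
pose k : {nonneg R} := NngNum vV0.
rewrite (eq_measure_integral (mscale k (vol3 R))); last first.
  move=> A mA AD; rewrite [LHS](XD mA) vD setIidl// muleC /mscale/=.
  by rewrite inver gt_eqF.
by rewrite ge0_integral_mscale//; exact: measurable_funTS.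
Qed.

(** As [f] is only Lebesgue measurable, f(X) need not be a random variable. A Borel modification g
    gives one, g(X), which almost surely agrees with f(X) because [X] lies in [D] and avoids the
    null set. *)
Lemma has_expectation_uniform (f : R3 R -> R) :
  (leb3 R).-integrable D (EFin \o f) ->
  has_expectation P (f \o X) ((v^-1)%:E * \int[leb3 R]_(x in D) (f x)%:E).
Proof.
move=> intf.
have /measurable_EFinP mf := measurable_int _ intf.
have Doo : vol3 R D < +oo by rewrite vD ltry.
have [g [N [mg mN N0 fg intg]]] := completed_measurable_modification mD Doo mf.
have transfer (phi : \bar R -> \bar R) : measurable_fun setT phi ->
    (forall y, 0 <= phi y) ->
    \int[P]_w phi (g (X w))%:E = (v^-1)%:E * \int[leb3 R]_(x in D) phi (f x)%:E.
  move=> mphi phi0; rewrite intg//.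
  apply: (ge0_integral_uniform (h := fun x => phi (g x)%:E)) => //.
  by apply: measurableT_comp => //; exact/measurable_EFinP.
have mY : measurable_fun setT (g \o X : Omega -> R) by exact: measurableT_comp.
pose Y : {RV P >-> R} := HB.pack (g \o X) (isMeasurableFun.Build _ _ _ _ _ mY).
have /integrableP[_ intf_fin] := intf.
have vV0 : 0 <= (v^-1)%:E by rewrite lee_fin invr_ge0 ltW.
have intY : P.-integrable setT (EFin \o Y).
  apply/integrableP; split; first by apply/measurable_EFinP; exact: mY.
  rewrite (transfer abse (@abse_measurable R setT) (@abse_ge0 R)).
  by rewrite lte_mul_pinfty.
exists Y; split => //.
- have NX : {ae P, forall w, ~ N (X w)}.
    apply: (uniform_null mN); apply/eqP; rewrite -measure_le0 -N0.
    by apply: le_measure; rewrite ?inE//; exact: measurableI.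
  apply: filterS2 uniform_in NX => w DX NXw; exact: fg.
- have Epos : \int[P]_w (fun w => (Y w)%:E)^\+ w =
      (v^-1)%:E * \int[leb3 R]_(x in D) (fun x => (f x)%:E)^\+ x.
    have mphi : measurable_fun setT (fun y : \bar R => maxe y 0).
      by apply: measurable_maxe.
    rewrite funepos.unlock; apply: (transfer _ mphi) => y.
    by rewrite le_max lexx orbT.
  have Eneg : \int[P]_w (fun w => (Y w)%:E)^\- w =
      (v^-1)%:E * \int[leb3 R]_(x in D) (fun x => (f x)%:E)^\- x.
    have mphi : measurable_fun setT (fun y : \bar R => maxe (- y) 0).
      by apply: measurable_maxe.
    rewrite funeneg.unlock; apply: (transfer _ mphi) => y.
    by rewrite le_max lexx orbT.
  rewrite unlock [LHS]integralE [in RHS]integralE Epos Eneg [RHS]muleBr//.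
  (* Distributing 1/v over the difference requires that it not be oo - oo; the negative part has
     finite integral. *)
  apply: fin_num_adde_defl.
  rewrite fin_numN.
  exact: (integrable_neg_fin_num (measurable_completed (vol3 R) mD) intf).
Qed.

End uniform.

(** * Polynomials of degree at most 1 *)

Lemma evalp_affine (R : realType) (q : mpoly.mpoly 3 R) : degree_le 1 q ->
  exists c a1 a2 a3 : R,
    evalp q = fun x => c + a1 * x.1.1 + a2 * x.1.2 + a3 * x.2.
Proof.
move=> q1.
suff: exists c a1 a2 a3 : R, forall x,
    evalp q x = c + a1 * x.1.1 + a2 * x.1.2 + a3 * x.2.
  by move=> [c [a1 [a2 [a3 E]]]]; exists c, a1, a2, a3; apply/funext.
rewrite /evalp /mpoly.meval /mpoly.mmap.
have : {in mpoly.msupp q, forall m, (mpoly.mdeg m <= 1)%N}.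
  by move=> m /mpoly.msize_mdeg_lt mq; rewrite -ltnS (leq_trans mq).
(* Induction on the list of monomials, with the coefficients of [q] kept fixed. *)
elim: (mpoly.msupp q : seq _) => [|m s IHs] ms.
  by exists 0, 0, 0, 0 => x; rewrite big_nil; ring.
have [|c [a1 [a2 [a3 E]]]] := IHs.
  by move=> m' m's; apply: ms; rewrite inE m's orbT.
have := ms m; rewrite mem_head => /(_ isT).
rewrite mpoly.mdegE !big_ord_recl big_ord0.
pose k := mpoly.mcoeff m q.
set m1 := m _; set m2 := m _; set m3 := m _ => m_le1.
(* At most one exponent is 1, so the exponents and the test for the constant monomial act as
   indicators that send [k] to the right coefficient. *)
exists (c + k * (m1 + (m2 + (m3 + 0)) == 0)%N%:R), (a1 + k * m1%:R),
  (a2 + k * m2%:R), (a3 + k * m3%:R) => x.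
rewrite big_cons E /mpoly.mmap1 !big_ord_recl big_ord0 -/m1 -/m2 -/m3 -/k !mxE/=.
by move: m1 m2 m3 m_le1 => [|[|?]] [|[|?]] [|[|?]] //= _; ring.
Qed.

(** The set has finite volume and the function is bounded there: adding face inequalities in pairs
    puts every coordinate in [-1, 1]. *)
Lemma integrable_affine_tetrahedron (R : realType) (c a1 a2 a3 : R) :
  (leb3 R).-integrable (tetrahedron R)
    (EFin \o (fun x => c + a1 * x.1.1 + a2 * x.1.2 + a3 * x.2)).
Proof.
apply: measurable_bounded_integrable.
- exact: (measurable_completed (vol3 R) measurable_tetrahedron).
- apply: (@le_lt_trans _ _ (vol3 R (tetrahedron R))).
    by rewrite -(completed_measureE (vol3 R) measurable_tetrahedron).
  by rewrite vol3_tetrahedron ltry.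
- apply: measurable_fun_completed; [exact: measurable_tetrahedron|].
  exact: measurable_affine.
- exists (`|c| + `|a1| + `|a2| + `|a3|); split; first exact: num_real.
  move=> M ltM x /tetrahedronE[? ? ? ?].
  rewrite /= (le_trans _ (ltW ltM))//.
  have le1 (a y : R) : `|y| <= 1 -> `|a * y| <= `|a|.
    by move=> y1; rewrite normrM ler_piMr.
  do 3 (apply: (le_trans (ler_normD _ _)); apply: lerD => //;
    last by apply: le1; rewrite ler_norml; lra).
Qed.

(** * The four-point rule *)

Section quadrature.
Context (R : realType) (d : measure_display) (Omega : measurableType d).
Variable P : probability Omega R.

(** Bundled as a random variable so that it can be iterated: the nodes become its iterates, and
    their uniformity follows by induction. *)
Definition rotateRV (X : {RV P >-> R3 R}) : {RV P >-> R3 R} :=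
  HB.pack (mxact (R0 R) \o X) (isMeasurableFun.Build _ _ _ _ (mxact (R0 R) \o X)
    (measurableT_comp measurable_mxactR0 (measurable_funPT X))).

(** Since [R0] preserves the tetrahedron, the preimage of A within it is the preimage of A
    intersected with it, which has the same volume as that intersection. *)
Lemma uniform_rotateRV (X : {RV P >-> R3 R}) :
  uniform_on (tetrahedron R) X -> uniform_on (tetrahedron R) (rotateRV X).
Proof.
move=> XT A mA.
have mrot (E : set (R3 R)) : measurable E ->
    measurable (mxact (R0 R) @^-1` E : set (R3 R)).
  by move=> mE; rewrite -[X in measurable X]setTI; exact: measurable_mxactR0.
rewrite -[LHS]/(distribution P X (mxact (R0 R) @^-1` A)) XT; last exact: mrot.
rewrite -(vol3_mxactR0 (measurableI _ _ mA measurable_tetrahedron)) preimage_setI.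
rewrite (_ : mxact (R0 R) @^-1` tetrahedron R = tetrahedron R)//.
by apply/seteqP; split => x /tetrahedron_mxactR0.
Qed.

Lemma iter_rotateRV (X : {RV P >-> R3 R}) n w :
  iter n rotateRV X w = mxact (R0 R ^+ n) (X w).
Proof.
elim: n => [|n IHn] /=.
  by rewrite mxact1.
by rewrite exprS mxactM -IHn.
Qed.

Lemma has_expectationD (Z1 Z2 : Omega -> R) (m1 m2 : \bar R) :
  has_expectation P Z1 m1 -> has_expectation P Z2 m2 ->
  has_expectation P (fun w => Z1 w + Z2 w) (m1 + m2)%E.
Proof.
move=> [Y1 [iY1 ZY1 <-]] [Y2 [iY2 ZY2 <-]].
exists (Y1 \+ Y2)%R; split.
- by apply: eq_integrable (integrableD measurableT iY1 iY2).
- by apply: filterS2 ZY1 ZY2 => w /= -> ->.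
- by rewrite unlock -integralD.
Qed.

Lemma has_expectationZ (k : R) (Z : Omega -> R) (m : \bar R) :
  has_expectation P Z m -> has_expectation P (fun w => k * Z w) (k%:E * m)%E.
Proof.
move=> [Y [iY ZY <-]].
exists (k \o* Y)%R; split.
- apply: eq_integrable (integrableZl measurableT k iY) => // w _.
  by rewrite /= mulrC EFinM.
- by apply: filterS ZY => w /= ->; rewrite mulrC.
- rewrite unlock -integralZl//; apply: eq_integral => w _.
  by rewrite /= mulrC EFinM.
Qed.

(** Shows that the expectation of a constant is determined although its witness is fixed only almost
    surely; this lets an integral be read off from a constant rule. *)
Lemma has_expectation_cst (c : R) (m : \bar R) :
  has_expectation P (fun=> c) m -> m = c%:E.
Proof.
move=> [Y [iY cY <-]]; rewrite unlock.
have -> : (\int[P]_w (Y w)%:E = \int[P]_w (cst c%:E) w)%E.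
  apply: ae_eq_integral => //; first by apply/measurable_EFinP.
  by apply: filterS cY => w -> _.
by have := expectation_cst P c; rewrite unlock.
Qed.

Lemma QME (X : Omega -> R3 R) (f : R3 R -> R) w :
  QM X f w = 2 / 3 * \sum_(j < 4) f (mxact (R0 R ^+ j) (X w)).
Proof. by rewrite !big_ord_recl big_ord0 /= expr0 expr1 mxact1 addr0 !addrA. Qed.

Lemma stochastic_quadrature_rule_QM (X : {RV P >-> R3 R}) :
  uniform_on (tetrahedron R) X ->
  stochastic_quadrature_rule P (tetrahedron R) (QM X).
Proof.
move=> XT; exists 4%N, (fun j => iter j rotateRV X), (fun=> cst (2 / 3)%R).
split; last first.
  move=> f w; rewrite QME mulrC mulr_suml; apply: eq_bigr => j _.
  by rewrite iter_rotateRV.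
apply: filterS (uniform_in measurable_tetrahedron XT) => w Tw j.
elim: (j : nat) => //= n Tn; exact/tetrahedron_mxactR0.
Qed.

Lemma unbiased_QM (X : {RV P >-> R3 R}) :
  uniform_on (tetrahedron R) X -> unbiased P (tetrahedron R) (QM X).
Proof.
move=> XT f intf.
have XnT n : uniform_on (tetrahedron R) (iter n rotateRV X).
  by elim: n => // n; exact: uniform_rotateRV.
have v0 : 0 < 8 / 3 :> R by [].
have EX n : has_expectation P (fun w => f (mxact (R0 R ^+ n) (X w)))
    ((8 / 3)^-1%:E * \int[leb3 R]_(x in tetrahedron R) (f x)%:E)%E.
  have := has_expectation_uniform measurable_tetrahedron (XnT n) v0
    vol3_tetrahedron intf.
  rewrite (_ : f \o _ = fun w => f (mxact (R0 R ^+ n) (X w)))//.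
  by apply/funext => w /=; rewrite iter_rotateRV.
(* The integral is finite, so the extended-real sum reduces to real arithmetic. *)
pose I := fine (\int[leb3 R]_(x in tetrahedron R) (f x)%:E)%E.
have IE : (\int[leb3 R]_(x in tetrahedron R) (f x)%:E = I%:E)%E.
  rewrite fineK//; apply: integrable_fin_num intf.
  exact: (measurable_completed (vol3 R) measurable_tetrahedron).
rewrite IE in EX *.
have := has_expectationZ (2 / 3) (has_expectationD (has_expectationD
  (has_expectationD (EX 0%N) (EX 1%N)) (EX 2%N)) (EX 3%N)).
(* The constants cancel: 2/3 * 4 * 3/8 = 1. *)
rewrite -!EFinM (_ : 2 / 3 * _ = I); last by field.
rewrite (_ : (fun w => _) = QM X f)//.
by apply/funext => w; rewrite QME !big_ord_recl big_ord0 /= addr0 !addrA.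
Qed.

Lemma of_order_QM (X : {RV P >-> R3 R}) :
  uniform_on (tetrahedron R) X -> of_order P (tetrahedron R) (QM X) 1.
Proof.
(* Exactness holds at every outcome, not only almost surely. *)
move=> XT; apply: nearW => w q /evalp_affine[c [a1 [a2 [a3 qE]]]].
(* The linear terms cancel since I + R0 + R0^2 + R0^3 = 0, which leaves 2/3 * 4c. *)
have QMq w' : QM X (evalp q) w' = 8 / 3 * c.
  by rewrite qE /QM mxactR0 mxactR0X2 mxactR0X3 /=; field.
have := unbiased_QM XT (f := evalp q).
rewrite {1}qE => /(_ (integrable_affine_tetrahedron _ _ _ _)).
rewrite (_ : QM X (evalp q) = fun=> 8 / 3 * c); last exact: funext QMq.
by move=> /has_expectation_cst ->.
Qed.

End quadrature.

Theorem mainTheorem3 (R : realType) (d : measure_display)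
    (Omega : measurableType d) (P : probability Omega R)
    (X : {RV P >-> R3 R}) (hX : uniform_on (tetrahedron R) X) :
  [/\ stochastic_quadrature_rule P (tetrahedron R) (QM X),
      of_order P (tetrahedron R) (QM X) 1 &
      unbiased P (tetrahedron R) (QM X)].
Proof.
split; first exact: stochastic_quadrature_rule_QM.
- exact: of_order_QM.
- exact: unbiased_QM.
Qed.
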